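(* Let $\Delta=\langle F_1,\dots,F_q\rangle$ be a simplicial complex, let $s\ge 2$ be an integer, and let $\alpha,\beta\in\mathcal{I}_s$ with $\mathrm{Supp}(\alpha)\cap\mathrm{Supp}(\beta)=\emptyset$. Let $I=(f_1,\dots,f_q)$ be the facet ideal of $\Delta$. If $\mathcal{C}_{\alpha,\beta}$ is not a simplicial even walk, then $$T_{\alpha,\beta}(I)\in J_1S+J_{s-1}S.$$
   Context: Let $\Delta=\langle F_1,\dots,F_q\rangle$ be a simplicial complex with (distinct) facets $F_1,\dots,F_q$ on vertex set $V(\Delta)=\{x_1,\dots,x_n\}$, $R=\mathbb{K}[x_1,\dots,x_n]$ with $\mathbb{K}$ a field, and $S=R[T_1,\dots,T_q]$. The facet ideal of $\Delta$ is $I=(f_1,\dots,f_q)$ with $f_i=\prod_{x\in F_i}x$. For $s\ge 1$ let $\mathcal{I}_s=\{(i_1,\dots,i_s): 1\le i_1\le\cdots\le i_s\le q\}$. For $\alpha=(i_1,\dots,i_s)\in\mathcal{I}_s$ put $\mathrm{Supp}(\alpha)=\{i_1,\dots,i_s\}$, $f_\alpha=f_{i_1}\cdots f_{i_s}$, $T_\alpha=T_{i_1}\cdots T_{i_s}$, and $\deg_\alpha(x)=\max\{m:x^m\mid f_\alpha\}$ for a vertex $x$. For $\alpha,\beta\in\mathcal{I}_s$, $$T_{\alpha,\beta}(I)=\frac{\mathrm{lcm}(f_\alpha,f_\beta)}{f_\alpha}T_\alpha-\frac{\mathrm{lcm}(f_\alpha,f_\beta)}{f_\beta}T_\beta .$$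 For $s\ge1$, $J_s$ is the $R$-submodule of $S$ generated by all $T_{\alpha,\beta}(I)$ with $\alpha,\beta\in\mathcal{I}_s$ and $\mathrm{Supp}(\alpha)\cap\mathrm{Supp}(\beta)=\emptyset$; $J_sS$ is the ideal of $S$ it generates. For $s\ge2$, $\alpha=(i_1,\dots,i_s)$, $\beta=(j_1,\dots,j_s)\in\mathcal{I}_s$, the sequence of not necessarily distinct facets $\mathcal{C}_{\alpha,\beta}=F_{i_1},F_{j_1},\dots,F_{i_s},F_{j_s}$ is a simplicial even walk if for every $i\in\mathrm{Supp}(\alpha)$ and $j\in\mathrm{Supp}(\beta)$ we have $F_i\setminus F_j\not\subseteq\{x\in V(\Delta):\deg_\alpha(x)>\deg_\beta(x)\}$ and $F_j\setminus F_i\not\subseteq\{x\in V(\Delta):\deg_\alpha(x)<\deg_\beta(x)\}$. *)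

(* Defs.v *)
From mathcomp Require Import all_boot all_order all_algebra.
From mathcomp.multinomials Require Export mpoly.

Set Implicit Arguments.
Unset Strict Implicit.
Unset Printing Implicit Defensive.

Import GRing.Theory.
Local Open Scope ring_scope.

Section Complexes.
Variable n : nat.
Implicit Types D : {set {set 'I_n}}.

(* The vertex x_i is the ordinal i : 'I_n. *)
Definition simplicial_complex D : Prop :=
  forall A B : {set 'I_n}, A \in D -> B \subset A -> B \in D.

Definition facets D : {set {set 'I_n}} :=
  [set A | maxset (fun B => B \in D) A].

(* D = <F_1, ..., F_q> with pairwise distinct facets F_1, ..., F_q. *)
Definition has_facets D (q : nat) (F : 'I_q -> {set 'I_n}) : Prop :=
  [/\ simplicial_complex D, injective F & [set F i | i : 'I_q] = facets D].
End Complexes.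

(* The index set I_s of weakly increasing sequences i_1 <= ... <= i_s in
   {1, ..., q} (shifted to {0, ..., q-1}). *)
Definition midx (q s : nat) : Type :=
  {a : s.-tuple 'I_q | sorted (fun i j : 'I_q => (i <= j)%N) a}.

Definition supp (q s : nat) (a : midx q s) : {set 'I_q} :=
  [set i | i \in val a].

Section Monomials.
Variables (n q : nat) (F : 'I_q -> {set 'I_n}).

(* A monomial of K[x_1, ..., x_n] is handled through its exponent vector, an
   element of 'X_{1..n}; the law of 'X_{1..n} is written additively, its order
   (_ <= _)%MM is divisibility and the corresponding polynomial is 'X_[m].  *)
Definition facet_mon (i : 'I_q) : 'X_{1..n} :=
  (\big[mnm_add/mnm0]_(x in F i) U_(x))%MM.

Definition fmon (s : nat) (a : midx q s) : 'X_{1..n} :=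
  (\big[mnm_add/mnm0]_(i <- val a) facet_mon i)%MM.

(* deg_alpha(x) = max {m : x^m | f_alpha}; the total degree of f_alpha bounds
   all the m that can occur. *)
Definition degm (s : nat) (a : midx q s) (x : 'I_n) : nat :=
  \max_(m < (mdeg (fmon a)).+1 | (U_(x) *+ m <= fmon a)%MM) m.

Lemma degmE (s : nat) (a : midx q s) (x : 'I_n) : degm a x = fmon a x.
Proof.
have dvdE (m : nat) : (U_(x) *+ m <= fmon a)%MM = (m <= fmon a x)%N.
  apply/mnm_lepP/idP => [/(_ x)|le_m y].
    by rewrite mulmnE mnm1E eqxx mul1n.
  by rewrite mulmnE mnm1E; case: eqP => [<-|_]; rewrite ?mul1n ?mul0n.
have lt_d : (fmon a x < (mdeg (fmon a)).+1)%N.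
  by rewrite ltnS mdegE (bigD1 x) //= leq_addr.
apply/eqP; rewrite eqn_leq; apply/andP; split.
  by apply/bigmax_leqP => m; rewrite dvdE.
by apply: (bigmax_sup (Ordinal lt_d)); rewrite ?dvdE.
Qed.

Definition simplicial_even_walk (s : nat) (a b : midx q s) : Prop :=
  forall i j : 'I_q, i \in supp a -> j \in supp b ->
    ~~ (F i :\: F j \subset [set x | (degm b x < degm a x)%N]) /\
    ~~ (F j :\: F i \subset [set x | (degm a x < degm b x)%N]).
End Monomials.

Definition submod_gen (A : nzRingType) (M : lmodType A) (G : M -> Prop)
    (u : M) : Prop :=
  exists r : seq (A * M),
    (forall p, p \in r -> G p.2) /\ u = \sum_(p <- r) p.1 *: p.2.

Definition ideal_gen (A : comNzRingType) (G : A -> Prop) (u : A) : Prop :=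
  exists r : seq (A * A),
    (forall p, p \in r -> G p.2) /\ u = \sum_(p <- r) p.1 * p.2.

Definition ideal_sum (A : comNzRingType) (P Q : A -> Prop) (u : A) : Prop :=
  exists v w, [/\ P v, Q w & u = v + w].

Section Rees.
Variables (K : fieldType) (n q : nat) (F : 'I_q -> {set 'I_n}).

Local Notation R := {mpoly K[n]}.
Local Notation S := {mpoly R[q]}.

Definition Tmon (s : nat) (a : midx q s) : S := \prod_(i <- val a) 'X_i.

(* T_{alpha,beta}(I); the subtractions of exponent vectors are exact, being
   the quotients lcm(f_alpha, f_beta) / f_alpha and
   lcm(f_alpha, f_beta) / f_beta. *)
Definition Tbin (s : nat) (a b : midx q s) : S :=
  'X_[K, mlcm (fmon F a) (fmon F b) - fmon F a] *: Tmon a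
  - 'X_[K, mlcm (fmon F a) (fmon F b) - fmon F b] *: Tmon b.

Definition J (s : nat) : S -> Prop :=
  submod_gen (A := R) (fun t : S => exists a b : midx q s,
    supp a :&: supp b = set0 /\ t = Tbin a b).

Definition JS (s : nat) : S -> Prop := ideal_gen (J s).
End Rees.

Arguments Tbin K {n q} F {s} a b.
Arguments J K {n q} F s _.
Arguments JS K {n q} F s _.

(* Main.v *)
Require Import Defs.
From mathcomp Require Import all_boot all_order all_algebra.
From mathcomp Require Import zify.

(** If [F_j \ F_i] lies in [{x | deg_alpha x < deg_beta x}] for some [i] in
    [Supp alpha] and [j] in [Supp beta], write [alpha = (i, alpha')] and
    [beta = (j, beta')].  The hypothesis is exactly what makes
    [lcm(f_i, f_j) / f_i] divide [lcm(f_alpha, f_beta) / f_alpha], so a multiple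
    of [T_alpha' T_{i,j}] replaces [T_i T_alpha'] by [T_j T_alpha'] in the first
    term of [T_{alpha,beta}]; both terms then share the factor [T_j], and what
    is left is a multiple of [T_j T_{alpha',beta'}].  The other way of failing
    to be an even walk is this one with [alpha] and [beta] exchanged. *)

Set Implicit Arguments.
Unset Strict Implicit.
Unset Printing Implicit Defensive.

Import GRing.Theory.

Section Indices.
Variables q s : nat.

(** Deleting one occurrence keeps the sequence sorted. Equality up to permutation suffices, since
    [fmon], [Tmon] and [supp] ignore order. *)
Lemma midx_rem (a : midx q s) (i : 'I_q) :
  i \in supp a -> exists a' : midx q s.-1, perm_eq (val a) (i :: val a').
Proof.
rewrite inE => ia.
have sz : size (rem i (val a)) == s.-1 by rewrite size_rem // size_tuple.
have so : sorted (fun i j : 'I_q => (i <= j)%N) (Tuple sz).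
  apply: subseq_sorted (rem_subseq i (val a)) (valP a).
  by move=> x y z; apply: leq_trans.
by exists (exist _ (Tuple sz) so); apply: perm_to_rem.
Qed.

Definition midx1 (i : 'I_q) : midx q 1 := exist _ [tuple i] isT.

Lemma supp_midx1 (i : 'I_q) : supp (midx1 i) = [set i].
Proof. by apply/setP => k; rewrite !inE. Qed.

Lemma supp_cons (a : midx q s) (i : 'I_q) (a' : midx q s.-1) :
  perm_eq (val a) (i :: val a') -> supp a = i |: supp a'.
Proof. by move=> /perm_mem pa; apply/setP => k; rewrite !inE pa inE. Qed.

End Indices.

Section Algebra.
Local Open Scope ring_scope.

(** The hypothesis identifies the two cross terms in [y * a], which then cancel. *)
Lemma scale_telescope (A : comNzRingType) (M : comAlgType A)
    (e d k l k' l' : A) (x y a b : M) : e * l = d * k' ->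
  (e * k) *: (x * a) - (d * l') *: (y * b) =
    (e *: a) * (k *: x - l *: y) + (d *: y) * (k' *: a - l' *: b).
Proof.
move=> eq_ed; have scM (c c' : A) (p p' : M) :
    (c *: p) * (c' *: p') = (c * c') *: (p * p').
  by rewrite -scalerAl -scalerAr scalerA.
by rewrite !mulrBr !scM eq_ed (mulrC a x) (mulrC a y) addrA subrK.
Qed.

Lemma mulrDr_assoc (A : nzRingType) (c d e x y : A) :
  c * (d * x + e * y) = c * d * x + c * e * y.
Proof. by rewrite mulrDr !mulrA. Qed.

End Algebra.

(** Used with [u], [v], [a], [b] the exponents of the monomials of [i], [j], [alpha'], [beta']. The
    last equation matches the cross terms of [scale_telescope]. *)
Lemma mlcm_exchange (n : nat) (u v a b : 'X_{1..n}) :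
  (mlcm u v - u <= mlcm (u + a) (v + b) - (u + a))%MM ->
  exists e d : 'X_{1..n},
    [/\ mlcm (u + a) (v + b) - (u + a) = e + (mlcm u v - u),
        mlcm (u + a) (v + b) - (v + b) = d + (mlcm a b - b) &
        e + (mlcm u v - v) = d + (mlcm a b - a)]%MM.
Proof.
move=> /mnm_lepP le_uv.
exists (mlcm (u + a) (v + b) - (u + a) - (mlcm u v - u))%MM.
(* This truncated difference is exact: [v + b] lies below the big lcm trivially, and [v + a] does by
   the hypothesis. *)
exists (mlcm (u + a) (v + b) - v - mlcm a b)%MM.
split; apply/mnmP => x; move: {le_uv}(le_uv x);
  rewrite !mlcmE !(mnmDE, mnmBE) !addKn; move: (u x) (v x) (a x) (b x).
- by move=> {u v a b} u v a b le_uv; rewrite subnK.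
- move=> {u v a b} u v a b.
  by case: (leqP a b) => ab; case: (leqP (u + a) (v + b)) => uv; lia.
- move=> {u v a b} u v a b; case: (leqP a b) => ab;
    case: (leqP (u + a) (v + b)) => uvab; case: (leqP u v) => uv; lia.
Qed.

Section Monomials.
Variables (n q : nat) (F : 'I_q -> {set 'I_n}).

Lemma facet_monE (i : 'I_q) (x : 'I_n) : facet_mon F i x = (x \in F i).
Proof.
rewrite /facet_mon mnm_sumE; under eq_bigr do rewrite mnm1E.
have [xF|xF] := boolP (x \in F i).
  rewrite (bigD1 x) //= eqxx big1 // => y /andP[_ /negPf yx].
  by rewrite yx.
by apply: big1 => y yF; case: eqP yF xF => // -> ->.
Qed.

Lemma fmon_midx1 (i : 'I_q) : fmon F (midx1 i) = facet_mon F i.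
Proof. by rewrite /fmon big_seq1. Qed.

Lemma fmon_cons (s : nat) (a : midx q s) (i : 'I_q) (a' : midx q s.-1) :
  perm_eq (val a) (i :: val a') ->
  fmon F a = (facet_mon F i + fmon F a')%MM.
Proof. by move=> pa; rewrite /fmon (perm_big _ pa) big_cons. Qed.

End Monomials.

Section Rees.
Local Open Scope ring_scope.
Variables (K : fieldType) (n q : nat) (F : 'I_q -> {set 'I_n}).

Local Notation S := {mpoly {mpoly K[n]}[q]}.

Lemma Tmon_midx1 (i : 'I_q) : Tmon K n (midx1 i) = 'X_i.
Proof. by rewrite /Tmon big_seq1. Qed.

Lemma Tmon_cons (s : nat) (a : midx q s) (i : 'I_q) (a' : midx q s.-1) :
  perm_eq (val a) (i :: val a') -> Tmon K n a = 'X_i * Tmon K n a'.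
Proof. by move=> pa; rewrite /Tmon (perm_big _ pa) big_cons. Qed.

Lemma JS_mulTbin (s : nat) (a b : midx q s) (c : S) :
  supp a :&: supp b = set0 -> JS K F s (c * Tbin K F a b).
Proof.
move=> ab; exists [:: (c, Tbin K F a b)]; split; last by rewrite big_seq1.
move=> p; rewrite inE => /eqP-> /=.
exists [:: (1, Tbin K F a b)]; split; last by rewrite big_seq1 scale1r.
by move=> p'; rewrite inE => /eqP-> /=; exists a, b.
Qed.

Lemma TbinC (s : nat) (a b : midx q s) : Tbin K F b a = - Tbin K F a b.
Proof. by rewrite /Tbin opprB mlcmC. Qed.

Lemma Tbin_split (s : nat) (a b : midx q s) (i j : 'I_q) (a' b' : midx q s.-1) :
  perm_eq (val a) (i :: val a') -> perm_eq (val b) (j :: val b') ->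
  F j :\: F i \subset [set x | (degm F a x < degm F b x)%N] ->
  exists c d : S, Tbin K F a b =
    c * Tbin K F (midx1 i) (midx1 j) + d * Tbin K F a' b'.
Proof.
move=> pa pb sub.
have lt_ab x : x \in F j -> x \notin F i -> (fmon F a x < fmon F b x)%N.
  by move=> xj xi; have /subsetP/(_ x) := sub; rewrite !inE xi xj !degmE; apply.
(* Facet monomials are squarefree, so the left side has exponent 1 on [F j :\: F i] and 0 elsewhere;
   a strict degree inequality there is enough. *)
have le_quo : (mlcm (facet_mon F i) (facet_mon F j) - facet_mon F i <=
               mlcm (fmon F a) (fmon F b) - fmon F a)%MM.
  apply/mnm_lepP => x; rewrite !mlcmE !(mnmDE, mnmBE) !facet_monE !addKn.
  case: (x \in F j) (x \in F i) (lt_ab x) => [] [] // lt.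
  by rewrite subn_gt0 lt.
rewrite (fmon_cons F pa) (fmon_cons F pb) in le_quo.
have [e [d [Ea Eb Eed]]] := mlcm_exchange le_quo.
exists ('X_[e] *: Tmon K n a'), ('X_[d] *: 'X_j).
rewrite /Tbin !fmon_midx1 !Tmon_midx1 (Tmon_cons pa) (Tmon_cons pb).
rewrite (fmon_cons F pa) (fmon_cons F pb) Ea Eb.
rewrite !mpolyXD; apply: scale_telescope.
by rewrite -!mpolyXD Eed.
Qed.

(** The free factor [c] absorbs the sign that appears when [alpha] and [beta] are exchanged. *)
Lemma Tbin_mem (s : nat) (a b : midx q s) (i j : 'I_q) (c : S) :
  supp a :&: supp b = set0 -> i \in supp a -> j \in supp b ->
  F j :\: F i \subset [set x | (degm F a x < degm F b x)%N] ->
  ideal_sum (JS K F 1) (JS K F s.-1) (c * Tbin K F a b).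
Proof.
move=> ab ia jb sub.
have [a' pa] := midx_rem ia; have [b' pb] := midx_rem jb.
have [d [e ->]] := Tbin_split pa pb sub.
have disj k : k \in supp a -> k \in supp b -> false.
  by move=> ka kb; rewrite -(in_set0 k) -ab inE ka kb.
have [sa sb] := (supp_cons pa, supp_cons pb).
exists (c * d * Tbin K F (midx1 i) (midx1 j)), (c * e * Tbin K F a' b').
split; last exact: mulrDr_assoc.
(* Disjoint supports force [i] and [j] to differ. *)
- apply: JS_mulTbin; rewrite !supp_midx1; apply/setP => k; rewrite !inE.
  apply/negP => /andP[/eqP-> /eqP ij]; have := disj j.
  by rewrite -{1}ij => /(_ ia jb).
- apply: JS_mulTbin; apply/setP => k; rewrite [RHS]inE inE.
  apply/negP => /andP[ka kb]; have := disj k.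
  by rewrite sa sb => /(_ (setU1r _ ka) (setU1r _ kb)).
Qed.

End Rees.

Theorem theorem4p2 (K : fieldType) (n q : nat) (Delta : {set {set 'I_n}})
    (F : 'I_q -> {set 'I_n}) (hF : has_facets Delta F)
    (s : nat) (hs : 2 <= s) (alpha beta : midx q s)
    (hdisj : supp alpha :&: supp beta = set0)
    (hwalk : ~ simplicial_even_walk F alpha beta) :
  ideal_sum (JS K F 1) (JS K F s.-1) (Tbin K F alpha beta).
Proof.
(* As a Boolean over finite sets, failure of the walk condition yields an explicit pair without
   classical logic. *)
pose bad i j :=
  (F i :\: F j \subset [set x | (degm F beta x < degm F alpha x)%N]) ||
  (F j :\: F i \subset [set x | (degm F alpha x < degm F beta x)%N]).
have [/exists_inP[i ia /exists_inP[j jb /orP[sub|sub]]]|good] :=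
  boolP [exists i in supp alpha, exists j in supp beta, bad i j].
(* Here [beta], [alpha] and [j], [i] take the roles of [a], [b] and [i], [j], with [c = -1]. *)
- rewrite TbinC -mulN1r; apply: Tbin_mem sub => //.
  by rewrite setIC.
- by rewrite -[Tbin _ _ _ _]mul1r; apply: Tbin_mem sub.
case: hwalk => i j ia jb; apply/andP; rewrite -negb_or.
apply: contra good => bad_ij.
by apply/exists_inP; exists i => //; apply/exists_inP; exists j.
Qed.
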